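(* Let $M\geq 2$. For $q\in\mathbb{Z}$ let $c_q\in\mathbb{C}^M$ be the truncated discrete cosine function defined by $c_q[p]:=2\cos\!\big(\tfrac{2\pi pq}{4M-3}\big)$ for $p=0,\ldots,M-1$, and let $E$ be the $M\times M$ diagonal matrix with diagonal entries $\omega_k=e^{2\pi ik/(2M-1)}$, $k=0,\ldots,M-1$. Then the intensity measurement mapping $\mathcal{A}\colon\mathbb{C}^M/\mathbb{T}\to\mathbb{R}^{4M-4}$ defined by $$\mathcal{A}(x):=\{|\langle x,c_q\rangle|^2\}_{q=0}^{2M-2}\cup\{|\langle x,E^*c_q\rangle|^2\}_{q=1}^{2M-3}$$ is injective; that is, if $x,y\in\mathbb{C}^M$ satisfy $|\langle x,c_q\rangle|=|\langle y,c_q\rangle|$ for $q=0,\ldots,2M-2$ and $|\langle x,E^*c_q\rangle|=|\langle y,E^*c_q\rangle|$ for $q=1,\ldots,2M-3$, then $y=\omega x$ for some $\omega\in\mathbb{C}$ with $|\omega|=1$.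
   Context: The inner product on $\mathbb{C}^M$ is $\langle x,y\rangle=\sum_{p}x[p]\overline{y[p]}$, with coordinates indexed $p=0,\ldots,M-1$. $\mathbb{T}$ denotes the unit circle $\{\omega\in\mathbb{C}:|\omega|=1\}$, and $\mathbb{C}^M/\mathbb{T}$ is the set of equivalence classes $\{\omega x:|\omega|=1\}$. $E^*$ is the conjugate transpose of $E$. *)

(* Defs.v *)
From HB Require Import structures.
From mathcomp Require Import all_boot all_order all_algebra.
From mathcomp Require Import all_classical all_reals all_analysis.
From mathcomp Require Import complex.
Set Implicit Arguments. Unset Strict Implicit. Unset Printing Implicit Defensive.
Import Order.TTheory GRing.Theory Num.Theory.
Local Open Scope ring_scope.
Local Open Scope complex_scope.

Definition cinner (R : realType) (M : nat) (x y : 'I_M -> R[i]) : R[i] :=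
  \sum_(p < M) x p * (y p)^*.

Definition cosvec (R : realType) (M : nat) (q : int) : 'I_M -> R[i] :=
  fun p => ((2 * cos (2 * pi * (p%:R) * (q%:~R) / ((4 * M - 3)%:R))) : R)%:C.

Definition omega (R : realType) (M : nat) (k : nat) : R[i] :=
  (cos (2 * pi * k%:R / ((2 * M - 1)%:R)) +i* sin (2 * pi * k%:R / ((2 * M - 1)%:R)))%C.

(* E^* v where E = diag(omega_0,...,omega_{M-1}): (E^* v)[p] = conj(omega_p) v[p] *)
Definition Eadj_apply (R : realType) (M : nat) (v : 'I_M -> R[i]) : 'I_M -> R[i] :=
  fun p => (omega R M p)^* * v p.

Arguments cinner {R M} x y.
Arguments cosvec : clear implicits.
Arguments omega : clear implicits.
Arguments Eadj_apply {R M} v p.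

(* Main.v *)
Require Import Defs.
From HB Require Import structures.
From mathcomp Require Import all_boot all_order all_algebra.
From mathcomp Require Import all_classical all_reals all_analysis.
From mathcomp Require Import complex.
From mathcomp Require Import ring lra zify.
Import Order.TTheory GRing.Theory Num.Theory.
Local Open Scope ring_scope.

(** With [N = 4M - 3], the numbers [|<x, c_q>|^2] are samples of an even
    trigonometric polynomial of degree at most [2M - 2 < N / 2], so inverting the
    DFT on [Z/N] recovers its cosine coefficients (the "moments" of the Gram matrix
    [x_p conj(x_r)]).  The two samples missing for [E x] are forced: the moments of
    order [0] and [2M - 2] only involve the moduli [|x_p|], which [E] preserves, and
    the two resulting equations in the two missing samples are independent.
    Let [m] be the last index of the support.  Given [x_m, ..., x_(m-j+1)], the
    moment of order [2m - j] of [x] determines the real part of [x_m conj(x_(m-j))],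
    and that of [E x] the real part of [omega_j x_m conj(x_(m-j))].  Since [omega_j]
    is not real, [x] is recovered up to a phase by induction on [j]. *)

(** * Cosine sums over Z/N and their orthogonality relations *)

Section Trigonometry.
Variable R : realType.

Definition dcos (N k : nat) : R := cos (2 * pi * k%:R / N%:R).

(* The sum over Z/N of an even function, folded onto [0, (N - 1) / 2]. *)
Definition fold_weight (q : nat) : R := if q == 0%N then 1 else 2.

Lemma sin_natpi k : sin (k%:R * pi) = 0 :> R.
Proof.
elim: k => [|k IHk]; first by rewrite mul0r sin0.
by rewrite -natr1 mulrDl mul1r sinDpi IHk oppr0.
Qed.

Lemma sin_pi_frac_gt0 (a b : nat) : (0 < a < b)%N -> 0 < sin (pi * a%:R / b%:R) :> R.
Proof.
move=> /andP[a0 ab]; apply: sin_gt0_pi.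
have b0 : 0 < b%:R :> R by rewrite ltr0n; lia.
have p0 := pi_gt0 R.
apply/andP; split; first by rewrite divr_gt0 // mulr_gt0 // ltr0n.
by rewrite ltr_pdivrMr // ltr_pM2l // ltr_nat.
Qed.

Lemma dcos0 N : dcos N 0 = 1.
Proof. by rewrite /dcos mulr0 mul0r cos0. Qed.

Lemma dcos_sin N k : dcos N k = 1 - 2 * sin (pi * k%:R / N%:R) ^+ 2.
Proof.
rewrite /dcos (_ : _ / _ = (pi * k%:R / N%:R) *+ 2); last by rewrite mulr2n; ring.
by rewrite cos_mulr2n cos2sin2 mulr2n; ring.
Qed.

Lemma dcos_neq1 N k : (0 < k < N)%N -> dcos N k != 1.
Proof.
move=> /sin_pi_frac_gt0 s0; apply/eqP => d1; move: s0.
rewrite lt_neqAle => /andP[/eqP s0 _]; apply: s0; apply/esym/eqP.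
rewrite -sqrf_eq0; apply/eqP.
by move: d1; rewrite dcos_sin; lra.
Qed.

(** Evenness and periodicity in one: in half-angle form, the squared sine is invariant under t -> k
    pi - t. *)
Lemma dcos_compl N k a b : (0 < N)%N -> (a + b = k * N)%N -> dcos N a = dcos N b.
Proof.
move=> N0 ab; rewrite !dcos_sin.
have N0' : N%:R != 0 :> R by rewrite pnatr_eq0; lia.
have -> : pi * a%:R / N%:R = k%:R * pi - pi * b%:R / N%:R :> R.
  have -> : a%:R = k%:R * N%:R - b%:R :> R by rewrite -natrM -ab natrD addrK.
  by field.
rewrite sinB sin_natpi mul0r sub0r sqrrN exprMn.
by rewrite cos2sin2 sin_natpi expr0n /= subr0 mul1r.
Qed.

(** Telescoping of 2 sin(b) cos(2bq) = sin((2q+1)b) - sin((2q-1)b). *)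
Lemma dirichlet_kernel (b : R) K :
  sin b * (\sum_(q < K.+1) fold_weight q * cos (2 * b * q%:R)) =
  sin ((K.*2.+1)%:R * b).
Proof.
elim: K => [|K IHK].
  by rewrite big_ord1 mulr0 cos0 !mulr1 mul1r.
rewrite big_ord_recr mulrDr IHK /fold_weight /=.
have -> : (K.*2.+1)%:R * b = 2 * b * K.+1%:R - b.
  by rewrite -addnn -!natr1 natrD; ring.
have -> : (K.+1).*2.+1%:R * b = 2 * b * K.+1%:R + b.
  by rewrite -addnn -!natr1 natrD -!natr1; ring.
by rewrite sinB sinD; ring.
Qed.

(** At b = pi m / N the Dirichlet kernel reads sin(b) times the sum = sin(pi m) = 0, while 0 < m < N
    keeps sin(b) nonzero. *)
Lemma sum_dcos K m : (0 < m < K.*2.+1)%N ->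
  \sum_(q < K.+1) fold_weight q * dcos K.*2.+1 (m * q) = 0.
Proof.
move=> mN; set N := K.*2.+1.
have N0' : N%:R != 0 :> R by rewrite pnatr_eq0.
have s0 := sin_pi_frac_gt0 _ _ mN.
have := dirichlet_kernel (pi * m%:R / N%:R) K.
have -> : N%:R * (pi * m%:R / N%:R) = m%:R * pi :> R by field.
rewrite sin_natpi => /eqP; rewrite mulf_eq0 gt_eqF //= => /eqP e.
rewrite -[RHS]e; apply: eq_bigr => q _; congr (_ * cos _).
by rewrite natrM; field.
Qed.

Lemma sum_dcos0 K :
  \sum_(q < K.+1) fold_weight q * dcos K.*2.+1 (0 * q) = (K.*2.+1)%:R.
Proof.
under eq_bigr => q _ do rewrite mul0n dcos0 mulr1.
rewrite big_ord_recl; under eq_bigr => q _ do rewrite /fold_weight /=.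
rewrite big_const_ord iter_addr_0 /fold_weight /= -[K.*2.+1]addn1 natrD -mul2n natrM.
by rewrite -[2 *+ K]mulr_natr addrC.
Qed.

Definition absdiff (a b : nat) : nat := (a - b + (b - a))%N.

Lemma dcosM N a b q : dcos N (a * q) * dcos N (b * q) =
  (dcos N ((a + b) * q) + dcos N (absdiff a b * q)) / 2.
Proof.
wlog ab : a b / (a <= b)%N.
  move=> W; case: (leqP a b) => [|/ltnW] h; first exact: W.
  by rewrite mulrC W // addnC /absdiff [(b - a + _)%N]addnC.
rewrite /absdiff (eqP ab) add0n /dcos.
have -> : 2 * pi * ((a + b) * q)%:R / N%:R =
   2 * pi * (b * q)%:R / N%:R + 2 * pi * (a * q)%:R / N%:R :> R.
  by rewrite !natrM natrD; ring.
have -> : 2 * pi * ((b - a) * q)%:R / N%:R =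
   2 * pi * (b * q)%:R / N%:R - 2 * pi * (a * q)%:R / N%:R :> R.
  by rewrite !natrM natrB //; ring.
by rewrite cosD cosB; field.
Qed.

(* Number of sign choices with [p +/- r +/- n = 0]: four times the mean over Z/N of the
   product of the three cosines. *)
Definition resonance (p r n : nat) : nat :=
  ((p + r + n == 0) + (p + r == n) + (p + n == r) + (r + n == p))%N.

(** Product-to-sum, applied twice, yields four frequencies, all at most 2K < N. There is no
    aliasing: only a frequency equal to 0 contributes. *)
Lemma triple_dcos K p r n : (p + r + n <= K.*2)%N ->
  \sum_(q < K.+1) fold_weight q *
    (dcos K.*2.+1 (p * q) * dcos K.*2.+1 (r * q) * dcos K.*2.+1 (n * q)) =
  (K.*2.+1)%:R / 4 * (resonance p r n)%:R.
Proof.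
move=> le; set N := K.*2.+1.
have key m : (m <= K.*2)%N ->
    \sum_(q < K.+1) fold_weight q * dcos N (m * q) = N%:R * (m == 0%N)%:R.
  case: m => [_|m mK]; first by rewrite sum_dcos0 mulr1.
  by rewrite sum_dcos ?mulr0 // ltnS mK.
transitivity (\sum_(q < K.+1) 4^-1 *
  (fold_weight q * dcos N ((p + r + n) * q) +
   fold_weight q * dcos N (absdiff (p + r) n * q) +
   fold_weight q * dcos N ((absdiff p r + n) * q) +
   fold_weight q * dcos N (absdiff (absdiff p r) n * q))).
  apply: eq_bigr => q _.
  by rewrite dcosM mulrAC mulrDl !dcosM; field.
rewrite -big_distrr /= !big_split /= !key /absdiff; try lia.
rewrite -!mulrDr -!natrD mulrA [4^-1 * _]mulrC; congr (_ * _%:R).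
have -> : ((p + r - n + (n - (p + r)))%N == 0%N) = (p + r == n)%N by lia.
(* The order of [p] and [r] decides which of the two remaining frequencies matches r + n = p and
   which p + n = r. *)
rewrite /resonance; case: (leqP p r) => pr.
  have -> : ((p - r + (r - p) + n)%N == 0%N) = (r + n == p)%N by lia.
  have -> : ((p - r + (r - p) - n + (n - (p - r + (r - p))))%N == 0%N) = (p + n == r)%N by lia.
  by rewrite addnAC.
have -> : ((p - r + (r - p) + n)%N == 0%N) = (p + n == r)%N by lia.
have -> : ((p - r + (r - p) - n + (n - (p - r + (r - p))))%N == 0%N) = (r + n == p)%N by lia.
by [].
Qed.

End Trigonometry.

(** * Samples and moments of a matrix *)

Lemma resonance_eq0 p r n :
  (p + r + n != 0)%N -> (p + r != n)%N -> (p + n != r)%N -> (r + n != p)%N ->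
  resonance p r n = 0%N.
Proof. by rewrite /resonance => /negPf-> /negPf-> /negPf-> /negPf->. Qed.

(** Up to a positive factor depending on [n], a cosine coefficient of the samples. It is linear in
    [H], so it applies to differences of Gram matrices. *)
Definition moment (C : pzRingType) (L : nat) (H : nat -> nat -> C) (n : nat) : C :=
  \sum_(p < L.+1) \sum_(r < L.+1) H p r * (resonance p r n)%:R.
Arguments moment {C} L H n.

Section Samples.
Variables (R : realType) (L : nat).
Local Open Scope complex_scope.
Local Notation K := L.*2.
Local Notation N := K.*2.+1.
Implicit Types H D : nat -> nat -> R[i].

Definition sample H (q : nat) : R[i] :=
  \sum_(p < L.+1) \sum_(r < L.+1) H p r * (dcos R N (p * q) * dcos R N (r * q))%:C.

Lemma sample_moment H n : (n <= K)%N ->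
  \sum_(q < K.+1) (fold_weight R q * dcos R N (n * q))%:C * sample H q =
  (N%:R / 4)%:C * moment L H n.
Proof.
move=> nK; rewrite /moment /sample mulr_sumr.
under eq_bigr => q _ do rewrite mulr_sumr.
rewrite exchange_big /=; apply: eq_bigr => p _; rewrite mulr_sumr.
under eq_bigr => q _ do rewrite mulr_sumr.
rewrite exchange_big /=; apply: eq_bigr => r _.
have bnd : (p + r + n <= K.*2)%N by have := ltn_ord p; have := ltn_ord r; lia.
rewrite mulrCA -(rmorph_nat (real_complex R)) -rmorphM /= -triple_dcos //.
rewrite rmorph_sum mulr_sumr; apply: eq_bigr => q _ /=.
rewrite mulrCA -rmorphM /=; congr (_ * _%:C); ring.
Qed.

Lemma moment_eq0 H : (forall q, (q <= K)%N -> sample H q = 0) ->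
  forall n, (n <= K)%N -> moment L H n = 0.
Proof.
move=> H0 n nK; have := sample_moment H n nK.
rewrite big1 => [/esym/eqP|q _]; last by rewrite H0 ?mulr0 // -ltnS.
by rewrite mulf_eq0 -(rmorph0 (real_complex R)) (inj_eq (@complexI R)) mulf_eq0 invr_eq0 !pnatr_eq0 => /eqP.
Qed.

(** Order 0 resonates only for p = r, and order 2L only for p = r = L. *)
Lemma moment_diag H D : (forall p, D p p = H p p) ->
  (moment L D 0 = moment L H 0) * (moment L D K = moment L H K).
Proof.
move=> DH; split; apply: eq_bigr => p _; apply: eq_bigr => r _;
  (have [->|pr] := eqVneq (p : nat) (r : nat); first by rewrite DH);
  have := ltn_ord p; have := ltn_ord r => rL pL; rewrite resonance_eq0 ?mulr0 //; lia.
Qed.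

Lemma sample_endpoints H D : (0 < L)%N -> (forall p, D p p = H p p) ->
  (forall q, (q <= K)%N -> sample H q = 0) ->
  (forall q, (0 < q < K)%N -> sample D q = 0) ->
  forall q, (q <= K)%N -> sample D q = 0.
Proof.
move=> L0 DH H0 D0.
(* Interior samples vanish, so a zero moment leaves a linear relation between the two end samples,
   of weights 1 and 2. *)
have endE n : (n <= K)%N -> moment L D n = 0 ->
    sample D 0 + 2 * (dcos R N (n * K))%:C * sample D K = 0.
  move=> nK m0; have := sample_moment D n nK; rewrite m0 mulr0.
  rewrite big_ord_recl; have K0 : (0 < K)%N by lia.
  case: K K0 {nK m0} D0 => [//|k] _ D0.
  rewrite big_ord_recr /= big1 ?add0r.
    rewrite /fold_weight /bump /= muln0 dcos0 !mul1r rmorphM /=.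
    by rewrite rmorph_nat.
  by move=> i _; rewrite D0 ?mulr0 // /bump /=; have := ltn_ord i; lia.
have [m0 mK] := moment_diag H D DH.
have e0 := endE 0 (leq0n _); rewrite m0 (moment_eq0 H H0) // in e0.
have eK := endE K (leqnn _); rewrite mK (moment_eq0 H H0) // in eK.
move: (e0 erefl) (eK erefl); rewrite mul0n dcos0.
(* K^2 + L = 4L^2 + L = L N, so the order [K] relation has coefficient [dcos R N L], which differs
   from the 1 of order 0. *)
rewrite (dcos_compl R N L (K * K) L) //; last by lia.
have d1 : dcos R N L != 1 by apply: dcos_neq1; lia.
set c := (dcos R N L)%:C => {}e0 {}eK.
have c1 : c != 1 by rewrite /c -(rmorph1 (real_complex R)) (inj_eq (@complexI R)).
rewrite rmorph1 mulr1 in e0.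
have DK0 : sample D K = 0.
  apply/eqP; have : 2 * (c - 1) * sample D K = 0.
    by rewrite -[RHS](subrr 0) -{1}eK -e0; ring.
  by move/eqP; rewrite !mulf_eq0 subr_eq0 (negPf c1) pnatr_eq0.
move: e0; rewrite DK0 mulr0 addr0 => D00.
move=> [|q] qK; first exact: D00.
move: qK; rewrite leq_eqVlt => /predU1P[->//|qK].
by rewrite D0.
Qed.

End Samples.

(** * Recovering a vector downward from the end of its support *)

Section Descent.
Variables (C : numClosedFieldType) (L : nat).
Implicit Types H : nat -> nat -> C.

Lemma sum2_single (F : nat -> nat -> C) a b : (a <= L)%N -> (b <= L)%N ->
  (forall p r, (p <= L)%N -> (r <= L)%N -> (p != a) || (r != b) -> F p r = 0) ->
  \sum_(p < L.+1) \sum_(r < L.+1) F p r = F a b.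
Proof.
move=> aL bL F0.
rewrite (bigD1 (inord a)) //= (bigD1 (inord b)) //= !inordK // !big1 ?addr0 //.
- move=> p; rewrite -val_eqE /= inordK // => pa.
  by apply: big1 => r _; apply: F0; rewrite ?pa // -ltnS.
- by move=> r; rewrite -val_eqE /= inordK // => rb; apply: F0; rewrite ?rb ?orbT // -ltnS.
Qed.

(** For p, r <= m, the equation p + r = 2m - j puts both indices at or above m - j; as [H] vanishes
    when both exceed it, one is m - j and the other m. Since 2m - j >= m, the equation |p - r| = 2m
    - j only yields the pair m, 0 with j = m, the same pair. *)
Lemma moment_top H m j : (m <= L)%N -> (j <= m)%N ->
  (forall p r, (p <= L)%N -> (r <= L)%N -> (m < p)%N || (m < r)%N -> H p r = 0) ->
  (forall p r, (m - j < p)%N -> (m - j < r)%N -> (p <= L)%N -> (r <= L)%N -> H p r = 0) ->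
  moment L H (m.*2 - j) = 0 -> H m (m - j)%N + H (m - j)%N m = 0.
Proof.
move=> mL jm Hout Hin; rewrite /moment.
set n := (m.*2 - j)%N; set s := (m - j)%N.
pose F p r := H p r * (resonance p r n)%:R.
have F0 p r : (p <= L)%N -> (r <= L)%N -> ~~ ((p == m) && (r == s)) ->
    ~~ ((p == s) && (r == m)) -> F p r = 0.
  move=> pL rL pr1 pr2; rewrite /F.
  have [out|] := boolP ((m < p)%N || (m < r)%N); first by rewrite Hout ?mul0r.
  rewrite negb_or -!leqNgt => /andP[pm rm].
  have [/andP[ps rs]|inn] := boolP ((s < p)%N && (s < r)%N); first by rewrite Hin ?mul0r.
  by rewrite resonance_eq0 ?mulr0 // /n; rewrite /s in pr1 pr2 inn; lia.
have FE p r : F p r = 0 -> resonance p r n != 0%N -> H p r = 0.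
  by move=> /eqP; rewrite mulf_eq0 pnatr_eq0 => /orP[/eqP//|->].
(* The multiplicity exceeds 1 when j = m; only its being nonzero matters. *)
have res1 : resonance m s n = (resonance m s n).-1.+1.
  by rewrite /resonance (_ : (m + s == n)%N) ?addn1 ?addnS //; rewrite /n /s; lia.
have res2 : resonance s m n = resonance m s n.
  by rewrite /resonance [(s + m)%N]addnC addnAC.
have sL : (s <= L)%N by rewrite /s; lia.
have [j0|jn0] := eqVneq j 0%N.
  have sm : s = m by rewrite /s j0 subn0.
  rewrite (sum2_single F m m) //.
    move=> /FE Hmm; rewrite sm in res1 *; rewrite Hmm ?addr0 //.
    by rewrite res1.
  by move=> p r pL rL pr; rewrite F0 // sm negb_and.
(* Separating row [m] leaves at most one nonzero entry in each double sum. *)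
pose F1 p r := if (p : nat) == m then F p r else 0.
pose F2 p r := if (p : nat) == m then 0 else F p r.
have -> : \sum_(p < L.+1) \sum_(r < L.+1) H p r * (resonance p r n)%:R =
   \sum_(p < L.+1) \sum_(r < L.+1) F1 p r + \sum_(p < L.+1) \sum_(r < L.+1) F2 p r.
  rewrite -big_split; apply: eq_bigr => p _; rewrite -big_split; apply: eq_bigr => r _.
  by rewrite /F1 /F2 /= /F; case: ifP => _; rewrite ?addr0 ?add0r.
have smn : s == m = false by rewrite /s; lia.
rewrite (sum2_single F1 m s) // ?(sum2_single F2 s m) //.
- rewrite /F1 /F2 eqxx smn /F res2 -mulrDl res1 => /eqP.
  by rewrite mulf_eq0 pnatr_eq0 orbF => /eqP.
- move=> p r pL rL pr; rewrite /F2; case: eqP => // /eqP pm; apply: F0 => //.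
    by rewrite (negPf pm).
  by rewrite negb_and.
- move=> p r pL rL pr; rewrite /F1; case: eqP => // pm; apply: F0 => //.
    by rewrite negb_and.
  by rewrite pm eq_sym smn.
Qed.

Variables x y w : nat -> C.
(** Difference of the Gram matrices of [y] and [x]; [D] is the same for their entrywise products
    with [w]. *)
Let H p r := y p * (y r)^* - x p * (x r)^*.
Let D p r := w p * (w r)^* * H p r.
Hypothesis w_nonreal : forall p r, (r < p <= L)%N ->
  w p * (w r)^* != (w p * (w r)^* )^*.
Hypothesis H0 : forall n, (n <= L.*2)%N -> moment L H n = 0.
Hypothesis D0 : forall n, (n <= L.*2)%N -> moment L D n = 0.

Lemma eq_up_to_phase : exists u, `|u| = 1 /\ forall p, (p <= L)%N -> y p = u * x p.
Proof.
(* [k] bounds both supports; induction lowers it until [x] is nonzero at the last index or nothing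
   is left. *)
suff gen k : (k <= L.+1)%N ->
    (forall p, (k <= p <= L)%N -> x p = 0 /\ y p = 0) ->
    exists u, `|u| = 1 /\ forall p, (p <= L)%N -> y p = u * x p.
  by apply: (gen L.+1) => // p; lia.
elim: k => [_ out|m IHm mL out].
  by exists 1; split=> [|p pL]; rewrite ?normr1 // ?mul1r; have [-> ->] := out p pL.
have Hout p r : (p <= L)%N -> (r <= L)%N -> (m < p)%N || (m < r)%N -> H p r = 0.
  move=> pL rL /orP[h|h]; rewrite /H.
    by have [|-> ->] := out p; rewrite ?h // !mul0r subr0.
  by have [|-> ->] := out r; rewrite ?h // conjC0 !mulr0 subr0.
have Dout p r : (p <= L)%N -> (r <= L)%N -> (m < p)%N || (m < r)%N -> D p r = 0.
  by move=> pL rL h; rewrite /D Hout ?mulr0.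
(* With h = H m (m-j) and z = w m conj(w (m-j)), Hermitian symmetry turns the two moments into h +
   conj(h) = 0 and z h + conj(z h) = 0, so (z - conj(z)) h = 0. For j = 0, h is real and the first
   equation suffices. *)
have step j : (j <= m)%N ->
    (forall p r, (m - j < p)%N -> (m - j < r)%N -> (p <= L)%N -> (r <= L)%N -> H p r = 0) ->
    H m (m - j)%N = 0.
  move=> jm Hin.
  have nL : (m.*2 - j <= L.*2)%N by lia.
  have := moment_top H m j mL jm Hout Hin (H0 _ nL).
  have e1 := moment_top D m j mL jm Dout.
  have Hherm p r : H r p = (H p r)^*.
    by rewrite /H rmorphB !rmorphM /= !conjCK mulrC [x r * _]mulrC.
  have -> := Hherm m (m - j)%N => e2.
  have [j0|jn0] := eqVneq j 0%N.
    move: e2; rewrite j0 subn0 -Hherm => /eqP.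
    by rewrite -mulr2n mulrn_eq0 => /eqP.
  have {e1}/e1/(_ (D0 _ nL)) : forall p r, (m - j < p)%N -> (m - j < r)%N -> (p <= L)%N -> (r <= L)%N -> D p r = 0.
    by move=> p r *; rewrite /D Hin ?mulr0.
  rewrite /D (Hherm m) => e1.
  move: e2 e1; set h := H _ _ => /eqP; rewrite addrC addr_eq0 => /eqP ->.
  have mj : (m - j < m <= L)%N by lia.
  have := w_nonreal m (m - j)%N mj; rewrite rmorphM /= conjCK => nr.
  rewrite mulrN [w (m - j)%N * _]mulrC -mulrBl => /eqP; rewrite mulf_eq0 subr_eq0.
  by rewrite (negPf nr) => /eqP.
have Hmm : H m m = 0.
  rewrite -{2}(subn0 m); apply: step => // p r; rewrite subn0 => mp _ pL rL.
  by apply: Hout; rewrite ?mp.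
have nxy : `|y m| = `|x m|.
  apply/eqP; rewrite -(@eqrXn2 _ 2) ?normr_ge0 // !normCK.
  by rewrite -subr_eq0; apply/eqP.
have [x0|xn0] := eqVneq (x m) 0.
  apply: IHm => [|p /andP[]]; first by lia.
  rewrite leq_eqVlt => /predU1P[<- _|mp pL]; last by apply: out; rewrite mp.
  split=> //; apply/eqP; by rewrite -normr_eq0 nxy x0 normr0.
pose u := y m / x m.
have u1 : `|u| = 1 by rewrite /u normf_div nxy divff // normr_eq0.
have uu : u * u^* = 1 by rewrite -normCK u1 expr1n.
have yu : y m = u * x m by rewrite /u divfK.
exists u; split=> //.
(* Strong induction on depth: y = u x above m - j kills [H] on that block because |u| = 1, so [step]
   applies and [x m] cancels. *)
have low j : (j <= m)%N -> forall p, (m - j <= p <= L)%N -> y p = u * x p.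
  elim/ltn_ind: j => j IHj jm p /andP[mp pL].
  have [mp'|pm] := ltnP m p.
    by have [|-> ->] := out p; rewrite ?mp' // mulr0.
  have [mjp|pmj] := ltnP (m - j) p.
    by apply: (IHj (m - p)%N); lia.
  have {mp pmj pm}-> : p = (m - j)%N by apply/eqP; rewrite eqn_leq pmj.
  have : H m (m - j)%N = 0.
    apply: step => // p' r' p'1 r'1 p'L r'L; rewrite /H.
    have eqlow q : (m - j < q)%N -> (q <= L)%N -> y q = u * x q.
      move=> q1 qL; have [mq|qm] := ltnP m q.
        by have [|-> ->] := out q; rewrite ?mq // mulr0.
      by apply: (IHj (m - q)%N); lia.
    rewrite !eqlow // rmorphM /= mulrACA uu mul1r subrr //.
  rewrite /H yu => /eqP; rewrite subr_eq0 mulrAC [x m * _]mulrC => /eqP /(mulIf xn0) e.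
  have {e}/(congr1 Num.conj) := e; rewrite rmorphM /= !conjCK => <-.
  by rewrite mulrA uu mul1r.
by move=> p pL; have [pm|mp] := leqP p m; [apply: (low m)|apply: (low 0%N)] => //; lia.
Qed.
End Descent.

(** * From inner products to samples *)

Section Measurements.
Variables (R : realType) (L : nat).

Lemma conj_complexE (a b : R) : ((a +i* b)%C)^* = (a -i* b)%C :> R[i].
Proof. by []. Qed.

(** [X] extends [x] to the index type of samples; the 4 is the square of the 2 in the cosine
    vectors. *)
Lemma normsq_cinner_cosvec (x : 'I_L.+1 -> R[i]) (X : nat -> R[i]) (q : nat) :
  (forall p : 'I_L.+1, x p = X p) ->
  `|cinner x (cosvec R L.+1 q%:Z)| ^+ 2 =
  4 * sample R L (fun p r => X p * (X r)^* ) q.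
Proof.
have conj_real (a : R) : (a%:C%C)^* = a%:C%C :> R[i] by exact: conjc_real.
move=> xX; set N := L.*2.*2.+1.
have -> : cinner x (cosvec R L.+1 q%:Z) =
    2 * \sum_(p < L.+1) X p * (dcos R N (p * q))%:C%C.
  rewrite /cinner mulr_sumr; apply: eq_bigr => p _.
  rewrite xX /cosvec (_ : (4 * L.+1 - 3)%N = N); last by rewrite /N; lia.
  rewrite conj_real rmorphM rmorph_nat /= mulrCA /dcos natrM.
  by congr (_ * (_ * (cos _)%:C%C)); rewrite !mulrA.
rewrite normCK rmorphM /= conjC_nat rmorph_sum /= mulrACA -natrM; congr (_ * _).
rewrite /sample mulr_suml; apply: eq_bigr => p _.
rewrite mulr_sumr; apply: eq_bigr => r _.
rewrite rmorphM /= conj_real mulrACA.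
by rewrite rmorphM.
Qed.

Lemma sampleB (F G : nat -> nat -> R[i]) q :
  sample R L (fun p r => F p r - G p r) q = sample R L F q - sample R L G q.
Proof.
rewrite /sample -sumrB; apply: eq_bigr => p _.
by rewrite -sumrB; apply: eq_bigr => r _; rewrite mulrBl.
Qed.

Lemma cinner_Eadj (x v : 'I_L.+1 -> R[i]) :
  cinner x (Eadj_apply v) = cinner (fun p => omega R L.+1 p * x p) v.
Proof.
apply: eq_bigr => p _.
by rewrite /Eadj_apply rmorphM /= conjCK mulrA [x p * _]mulrC.
Qed.

Lemma omega_mul_conj p : omega R L.+1 p * (omega R L.+1 p)^* = 1.
Proof.
rewrite /omega conj_complexE.
set t := (2 * pi * _ / _); have := cos2Dsin2 t; rewrite !expr2 => e.
by apply/eqP; rewrite eq_complex /= mulrN opprK e; apply/andP; split=> //; apply/eqP; ring.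
Qed.

(** The imaginary part is sin(2 pi (p - r) / (2L + 1)), positive because 0 < 2(p - r) < 2L + 1. *)
Lemma omega_mul_conj_nonreal p r : (r < p <= L)%N ->
  omega R L.+1 p * (omega R L.+1 r)^* != (omega R L.+1 p * (omega R L.+1 r)^* )^*.
Proof.
move=> prL; have /(sin_pi_frac_gt0 R) : (0 < 2 * (p - r) < 2 * L.+1 - 1)%N by lia.
rewrite natrM natrB; last by lia.
rewrite /omega conj_complexE.
set n := (2 * _ - 1)%:R.
have -> : pi * (2 * (p%:R - r%:R)) / n = 2 * pi * p%:R / n - 2 * pi * r%:R / n by ring.
rewrite sinB; set a := 2 * pi * _ / _; set b := 2 * pi * _ / _ => s0.
apply/eqP => /(congr1 (@complex.Im R)) /= e; move: s0.
rewrite (_ : _ - _ = 0) ?ltxx //.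
by lra.
Qed.
End Measurements.

Theorem theorem6 (R : realType) (M : nat) (hM : (2 <= M)%N)
  (x y : 'I_M -> R[i]) :
  (forall q : nat, (q <= 2 * M - 2)%N ->
     `|cinner x (cosvec R M q%:Z)| = `|cinner y (cosvec R M q%:Z)|) ->
  (forall q : nat, (1 <= q)%N -> (q <= 2 * M - 3)%N ->
     `|cinner x (Eadj_apply (cosvec R M q%:Z))| =
     `|cinner y (Eadj_apply (cosvec R M q%:Z))|) ->
  exists w : R[i], `|w| = 1 /\ (forall p : 'I_M, y p = w * x p).
Proof.
case: M hM x y => [//|L] L1 x y eq_cos eq_Ecos.
(* Extension by zero beyond index [L]. *)
pose ext (z : 'I_L.+1 -> R[i]) (p : nat) : R[i] := oapp z 0 (insub p).
have extE z (p : 'I_L.+1) : z p = ext z p by rewrite /ext valK.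
pose w := omega R L.+1.
pose H p r := ext y p * (ext y r)^* - ext x p * (ext x r)^*.
pose D p r := w p * (w r)^* * H p r.
have H0 q : (q <= L.*2)%N -> sample R L H q = 0.
  move=> qL; rewrite sampleB; apply/eqP; rewrite subr_eq0; apply/eqP.
  apply: (@mulfI _ 4); first by rewrite pnatr_eq0.
  rewrite -(normsq_cinner_cosvec R L y) // -(normsq_cinner_cosvec R L x) //.
  by rewrite eq_cos //; lia.
have D0 q : (0 < q < L.*2)%N -> sample R L D q = 0.
  move=> /andP[q0 qL].
  pose Ew z p := w p * ext z p.
  (* [D] is the Gram difference of E y and E x, so the measurements with E* apply to it. *)
  have -> : sample R L D q =
      sample R L (fun p r => Ew y p * (Ew y r)^* - Ew x p * (Ew x r)^*) q.
    apply: eq_bigr => p _; apply: eq_bigr => r _; congr (_ * _).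
    by rewrite /D /H /Ew !rmorphM /= mulrBr; congr (_ - _); rewrite mulrACA.
  rewrite sampleB; apply/eqP; rewrite subr_eq0; apply/eqP.
  apply: (@mulfI _ 4); first by rewrite pnatr_eq0.
  rewrite -(normsq_cinner_cosvec R L (fun p => w p * y p)); last first.
    by move=> p; rewrite extE.
  rewrite -(normsq_cinner_cosvec R L (fun p => w p * x p)); last first.
    by move=> p; rewrite extE.
  by rewrite -!cinner_Eadj eq_Ecos //; lia.
have DH p : D p p = H p p by rewrite /D omega_mul_conj mul1r.
have D0' := sample_endpoints R L H D L1 DH H0 D0.
have [u [u1 yux]] := eq_up_to_phase _ L (ext x) (ext y) w (omega_mul_conj_nonreal R L)
  (moment_eq0 R L H H0) (moment_eq0 R L D D0').
by exists u; split=> // p; rewrite !extE yux // -ltnS.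
Qed.
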